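(* For any $a\in\mathbb C$, $a\ne0$, and any $n\in\mathbb N_0$, the following identities for the Charlier polynomials hold: $$a\,\Delta_nC_n(x;a)=-x\,C_n(x-1;a),$$ $$n\,C_n(x;a)+a\,\frac{\partial}{\partial a}C_n(x;a)=n\,C_{n-1}(x;a),$$ $$(a-n)C_n(x;a)+n\nabla_nC_n(x;a)=a\,C_n(x+1;a),$$ $$(a-n-1)C_n(x;a)+a\,\Delta_nC_n(x;a)=a\,C_{n+1}(x+1;a).$$
   Context: $\mathbb N_0=\{0,1,2,\dots\}$; $(y)_j=y(y+1)\cdots(y+j-1)$. The Charlier polynomials are $C_n(x;a)={}_2F_0(-n,-x;-;-1/a)=\sum_{j=0}^n\frac{(-n)_j(-x)_j}{j!}(-1/a)^j$, with $C_{-1}=0$. The operators $\Delta_nf(n)=f(n+1)-f(n)$ and $\nabla_nf(n)=f(n)-f(n-1)$ act on the index $n$ with $x,a$ fixed. *)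

(* Defs.v *)
From HB Require Import structures.
From mathcomp Require Import all_boot all_order all_algebra.
From mathcomp Require Import all_classical all_reals all_analysis.
From mathcomp Require Import complex.
Set Implicit Arguments.
Unset Strict Implicit.
Unset Printing Implicit Defensive.
Import GRing.Theory Num.Theory.
Import numFieldNormedType.Exports.
Local Open Scope ring_scope.

Definition pochhammer (K : fieldType) (y : K) (j : nat) : K :=
  \prod_(i < j) (y + i%:R).

(* C_n(x; a) = 2F0(-n, -x; -; -1/a), a terminating series.  The degree ranges
   over int so that C_{-1} = 0 makes sense; degrees below -1 are also sent
   to 0, and are junk. *)
Definition charlier (K : fieldType) (n : int) (x a : K) : K :=
  match n with
  | Posz n =>
      \sum_(j < n.+1)
        pochhammer (- n%:R) j * pochhammer (- x) j / (j`!)%:R * (- 1 / a) ^+ j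
  | Negz _ => 0
  end.

Definition fwd_diff (V : zmodType) (f : int -> V) (n : int) : V :=
  f (n + 1) - f n.

Definition bwd_diff (V : zmodType) (f : int -> V) (n : int) : V :=
  f n - f (n - 1).

(* Main.v *)
Require Import Defs.
From HB Require Import structures.
From mathcomp Require Import all_boot all_order all_algebra.
From mathcomp Require Import all_classical all_reals all_analysis.
From mathcomp Require Import complex.
From mathcomp Require Import ring.
Set Implicit Arguments.
Unset Strict Implicit.
Unset Printing Implicit Defensive.
Import GRing.Theory Num.Theory.
Import numFieldNormedType.Exports.
Local Open Scope ring_scope.

(** Up to sign, (-n)_j / j! is a binomial coefficient, so the Charlier
    polynomial is the binomial transform S_n(f) = sum_j 'C(n, j) f_j of the
    sequence f_j(x; a) = (-x)_j a^(-j).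
    Each identity then splits into a fact about binomial transforms, valid for
    every sequence, and a one-line fact about the terms f_j:
    - Pascal's rule says that the difference in n of a transform is the
      transform of the shifted sequence ([binom_transformS]), and
      a f_(j+1)(x) = - x f_j(x - 1): this is the first identity;
    - the absorption rule j 'C(n, j) = n 'C(n - 1, j - 1) says that multiplying
      the terms by j is the same as shifting them, lowering n and multiplying
      by n ([binom_transform_index]).  Since a d/da f_j = - j f_j, the second
      identity is the form n S_n(f) - S_n(j f) = n S_(n-1)(f) of that rule
      ([binom_transform_euler]);
    - a f_j(x + 1) = a f_j(x) - j f_(j-1)(x), and the absorption rule turns
      this into a C_(n+1)(x + 1) = a C_(n+1)(x) - (n + 1) C_n(x)
      ([charlier_shift_arg]).  The third and fourth identities are this
      relation, at n - 1 and at n, written with differences; the third one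
      at n = 0 only says that C_0 = 1 at both arguments. *)

(** * Binomial transforms *)

Section BinomialTransform.
Variable K : pzRingType.
Implicit Types f : nat -> K.

Definition binom_transform (n : nat) f : K :=
  \sum_(j < n.+1) 'C(n, j)%:R * f j.

Lemma binom_transform0 f : binom_transform 0 f = f 0%N.
Proof. by rewrite /binom_transform big_ord1 bin0 mul1r. Qed.

(** Pascal's rule, summed against f. *)
Lemma binom_transformS n f :
  binom_transform n.+1 f
  = binom_transform n f + binom_transform n (fun j => f j.+1).
Proof.
rewrite /binom_transform big_ord_recl bin0.
under eq_bigr => j _ do rewrite lift0 binS natrD mulrDl.
rewrite big_split /= addrA; congr (_ + _).
(* the top term vanishes, as 'C(n, n.+1) = 0 *)
rewrite big_ord_recr /= bin_small // mul0r addr0.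
by rewrite [RHS]big_ord_recl bin0; under [in RHS]eq_bigr do rewrite lift0.
Qed.

(** The absorption rule j 'C(n + 1, j) = (n + 1) 'C(n, j - 1), summed
    against f. *)
Lemma binom_transform_index n f :
  binom_transform n.+1 (fun j => j%:R * f j)
  = n.+1%:R * binom_transform n (fun j => f j.+1).
Proof.
rewrite /binom_transform big_ord_recl mul0r mulr0 add0r mulr_sumr.
apply: eq_bigr => j _; rewrite lift0 !mulrA -!natrM.
by rewrite mul_bin_diag mulnC.
Qed.

(** The companion of the absorption rule, (n - j) 'C(n, j) = n 'C(n - 1, j);
    here it follows from absorption and Pascal's rule. *)
Lemma binom_transform_euler n f :
  n.+1%:R * binom_transform n.+1 f
    - binom_transform n.+1 (fun j => j%:R * f j)
  = n.+1%:R * binom_transform n f.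
Proof. by rewrite binom_transform_index binom_transformS mulrDr addrK. Qed.

End BinomialTransform.

(** * Pochhammer symbols *)

Lemma pochhammer0 (K : fieldType) (y : K) : pochhammer y 0 = 1.
Proof. by rewrite /pochhammer big_ord0. Qed.

Lemma pochhammerSr (K : fieldType) (y : K) j :
  pochhammer y j.+1 = pochhammer y j * (y + j%:R).
Proof. by rewrite /pochhammer big_ord_recr. Qed.

Lemma pochhammerSl (K : fieldType) (y : K) j :
  pochhammer y j.+1 = y * pochhammer (y + 1) j.
Proof.
rewrite /pochhammer big_ord_recl addr0; congr (_ * _).
by apply: eq_bigr => i _; rewrite lift0 -natr1; ring.
Qed.

(** The factors of (-n)_j are, up to sign, those of the falling factorial. *)
Lemma pochhammer_oppn (K : fieldType) n j :
  pochhammer (- n%:R : K) j = (-1) ^+ j * (n ^_ j)%:R.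
Proof.
elim: j => [|j IHj]; first by rewrite pochhammer0 ffactn0 mul1r.
rewrite pochhammerSr IHj ffactnSr natrM exprS.
have [le_jn | lt_nj] := leqP j n; first by rewrite natrB //; ring.
by rewrite ffact_small // !(mulr0, mul0r).
Qed.

(** * Charlier polynomials as binomial transforms *)

Section Charlier.
Variable K : numFieldType.
Implicit Types (a b x : K) (n j : nat).

Definition charlier_term x a j : K := pochhammer (- x) j * a^-1 ^+ j.

Lemma charlierE n x a :
  charlier n%:Z x a = binom_transform n (charlier_term x a).
Proof.
apply: eq_bigr => j _; rewrite pochhammer_oppn -bin_ffact natrM.
have fact_neq0 : (j`!)%:R != 0 :> K by rewrite pnatr_eq0 -lt0n fact_gt0.
(* the sign of (-n)_j cancels the one of (-1/a)^j *)
have -> : (- 1 / a) ^+ j = (-1) ^+ j * a^-1 ^+ j by rewrite exprMn.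
have signK : (-1) ^+ j * (-1) ^+ j = 1 :> K by rewrite -expr2 sqrr_sign.
rewrite /charlier_term -[RHS]mul1r -[X in _ = X * _]signK.
move: ((-1) ^+ j) (a^-1 ^+ j) (j`!%:R : K) fact_neq0 => s t f f_neq0.
by field.
Qed.

Lemma charlier_term_shift a x j : a != 0 ->
  a * charlier_term x a j.+1 = - x * charlier_term (x - 1) a j.
Proof.
move=> a0; rewrite /charlier_term pochhammerSl exprS opprB [1 - x]addrC.
by field.
Qed.

Lemma charlier_term_shift_arg a x j : a != 0 ->
  a * charlier_term (x + 1) a j
  = a * charlier_term x a j - j%:R * charlier_term x a j.-1.
Proof.
move=> a0; case: j => [|j].
  by rewrite /charlier_term !pochhammer0 mul0r subr0.
rewrite /charlier_term pochhammerSl pochhammerSr /= exprS.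
rewrite opprD subrK -natr1; field.
exact: a0.
Qed.

Lemma charlier_fwd_diff n x a : a != 0 ->
  a * fwd_diff (fun m => charlier m x a) n%:Z = - x * charlier n%:Z (x - 1) a.
Proof.
move=> a0; rewrite /fwd_diff -PoszD addn1 !charlierE binom_transformS.
rewrite addrC addKr /binom_transform !mulr_sumr; apply: eq_bigr => j _.
by rewrite mulrCA charlier_term_shift // mulrCA.
Qed.

Lemma charlier_shift_arg n x a : a != 0 ->
  a * charlier n.+1%:Z (x + 1) a
  = a * charlier n.+1%:Z x a - n.+1%:R * charlier n%:Z x a.
Proof.
move=> a0; rewrite !charlierE.
rewrite -(binom_transform_index n (fun j => charlier_term x a j.-1)).
rewrite /binom_transform !mulr_sumr -sumrB; apply: eq_bigr => j _.
by rewrite mulrCA charlier_term_shift_arg // mulrBr mulrCA.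
Qed.

Lemma charlier_bwd_diff n x a : a != 0 ->
  (a - n%:R) * charlier n%:Z x a
    + n%:R * bwd_diff (fun m => charlier m x a) n%:Z
  = a * charlier n%:Z (x + 1) a.
Proof.
move=> a0; rewrite /bwd_diff; case: n => [|n].
  rewrite !charlierE !binom_transform0 /charlier_term !pochhammer0.
  by rewrite mul0r addr0 subr0.
rewrite charlier_shift_arg // (_ : n.+1%:Z - 1 = n%:Z); first by ring.
by rewrite -addn1 PoszD addrK.
Qed.

Lemma charlier_fwd_diff_shift n x a : a != 0 ->
  (a - n%:R - 1) * charlier n%:Z x a
    + a * fwd_diff (fun m => charlier m x a) n%:Z
  = a * charlier (n%:Z + 1) (x + 1) a.
Proof.
move=> a0; rewrite /fwd_diff -PoszD addn1 charlier_shift_arg // -natr1; ring.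
Qed.

(** * The derivative in the parameter *)

Lemma is_derive_invX j a : a != 0 ->
  is_derive (a : K^o) 1 (fun b : K^o => b^-1 ^+ j : K^o)
    (- (j%:R * a^-1 ^+ j.+1)).
Proof.
move=> a0.
have inv_derive : is_derive (a : K^o) 1 (fun b : K^o => b^-1 : K^o) (- a ^- 2).
  apply: DeriveDef; first exact: (@derivableV K K^o id).
  by rewrite (@deriveV K K^o id) // derive_id [LHS]mulr1.
have := is_deriveX j inv_derive.
rewrite exprfctE => /is_derive_eq; apply.
case: j => [|j]; first by rewrite !mul0r scale0r oppr0.
by rewrite /GRing.scale /= -exprVn !exprS expr0; ring.
Qed.

(** a d/da multiplies the term of index j by - j. *)
Lemma is_derive_charlier n x a : a != 0 ->
  is_derive (a : K^o) 1 (fun b : K^o => charlier n%:Z x b : K^o)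
    (- a^-1 * binom_transform n (fun j => j%:R * charlier_term x a j)).
Proof.
move=> a0.
have term_derive (j : 'I_n.+1) : is_derive (a : K^o) 1
    (('C(n, j)%:R * pochhammer (- x) j) \*: (fun b : K^o => b^-1 ^+ j : K^o))
    (('C(n, j)%:R * pochhammer (- x) j) *: (- (j%:R * a^-1 ^+ j.+1) : K^o)).
  exact/is_deriveZ/is_derive_invX.
have := is_derive_sum term_derive.
rewrite (_ : \sum_(i < _) _ = (fun b : K^o => charlier n%:Z x b)); last first.
  apply/funext => b; rewrite charlierE fct_sumE; apply: eq_bigr => j _.
  by rewrite /charlier_term mulrA.
move=> /is_derive_eq; apply.
rewrite /binom_transform mulr_sumr; apply: eq_bigr => j _.
by rewrite /GRing.scale /= /charlier_term exprS; ring.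
Qed.

Lemma charlier_derive1 n x a : a != 0 ->
  n%:R * charlier n%:Z x a
    + a * derive1 (fun b : K => charlier n%:Z x b : K^o) a
  = n%:R * charlier (n%:Z - 1) x a.
Proof.
move=> a0; have [_ D_charlier] := is_derive_charlier n x a0.
rewrite derive1E D_charlier {D_charlier}.
rewrite mulNr mulrN mulrA divff // mul1r.
case: n => [|n].
  by rewrite binom_transform0 !mul0r subr0.
rewrite (_ : n.+1%:Z - 1 = n%:Z); last by rewrite -addn1 PoszD addrK.
by rewrite !charlierE binom_transform_euler.
Qed.

End Charlier.

Theorem lemma4p6 (R : realType) (a x : R[i]) (n : nat) (ha : a != 0) :
  [/\ a * fwd_diff (fun m => charlier m x a) n%:Z = - x * charlier n%:Z (x - 1) a,
      derivable (fun b : R[i]^o => charlier n%:Z x b : R[i]^o) a 1 /\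
      n%:R * charlier n%:Z x a + a * derive1 (fun b : R[i] => charlier n%:Z x b : R[i]^o) a
      = n%:R * charlier (n%:Z - 1) x a,
      (a - n%:R) * charlier n%:Z x a
        + n%:R * bwd_diff (fun m => charlier m x a) n%:Z
      = a * charlier n%:Z (x + 1) a
    & (a - n%:R - 1) * charlier n%:Z x a
        + a * fwd_diff (fun m => charlier m x a) n%:Z
      = a * charlier (n%:Z + 1) (x + 1) a].
Proof.
split.
- exact: charlier_fwd_diff.
- split; last exact: charlier_derive1.
  by have [] := is_derive_charlier n x ha.
- exact: charlier_bwd_diff.
- exact: charlier_fwd_diff_shift.
Qed.
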